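(* For each $r<0$ let $P_r(z,\zeta)$ be a Borel function on $D_r\times S_r$, and let $P(z,\zeta)$ be a Borel function on $D\times\partial D$. Define $Q_r(z,w)=\int_{S_r}P_r(z,\zeta)P_r(w,\zeta)\,d\mu_r(\zeta)$ and $Q_0(z,w)=\int_{\partial D}P(z,\zeta)P(w,\zeta)\,d\mu(\zeta)$. Suppose: (1) for each $z\in D$ the functions $P_r(z,\cdot)$ are non-negative and uniformly bounded on $S_r$ for $r$ close to $0$; (2) for each $z\in D$ and every sequence $r_j\nearrow0$, the sequence $\{P_{r_j}(z,\cdot)\}$ has weak limit values $P(z,\cdot)$ with respect to $\{\mu_{r_j}\}$; (3) $Q_0(z,z)=\lim_{r\to0^-}Q_r(z,z)$ for every $z\in D$. Then for each $z\in D$ and every sequence $r_j\nearrow0$, the sequence $\{P_{r_j}(z,\cdot)\}$ has strong limit values $P(z,\cdot)$ with respect to $\{\mu_{r_j}\}$.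
   Context: Standing setting: $D$ is a bounded domain in $\mathbb R^n$ exhausted by domains $D_r$, $r<0$, with $D_r\Subset D_s$ for $r<s<0$ and $\bigcup_{r<0}D_r=D$; $S_r=\partial D_r$. For each $r<0$, $\mu_r$ is a finite positive regular Borel measure supported on $S_r$, and $\mu_r\to\mu$ weak-* in $C(\overline D)^*$ as $r\to0^-$, where $\mu$ is a finite positive measure supported on $\partial D$; $K_0=\operatorname{supp}\mu$. Sequences indexed by $j$ are considered for $j$ large enough that the functions are defined. For a sequence $r_j\nearrow0$ and functions $\phi_j$ on $\operatorname{supp}\mu_{r_j}$: $\{\phi_j\}$ has weak limit values $\phi_*$ (a $\mu$-integrable function on $K_0$) if $\int h\phi_j\,d\mu_{r_j}\to\int_{K_0}h\phi_*\,d\mu$ for all $h\in C(\overline D)$; $\{\phi_j\}$ has strong limit values $\phi^*$ (a real $\mu$-measurable function on $K_0$) if for all real $a<b$ and $\varepsilon,\delta>0$ there are $j_0$ and an open set $O\subset\overline D$ containing $\{x\in K_0:a\le\phi^*(x)<b\}$ with $\mu_{r_j}(\{\phi_j<a-\varepsilon\}\cap O)+\mu_{r_j}(\{\phi_j>b+\varepsilon\}\cap O)<\delta$ for $j\ge j_0$. *)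

(* Defs.v *)
From HB Require Import structures.
From mathcomp Require Import all_boot all_order all_algebra.
From mathcomp Require Import all_classical all_reals all_analysis.
Set Implicit Arguments. Unset Strict Implicit. Unset Printing Implicit Defensive.
Import Order.TTheory GRing.Theory Num.Theory.
Import numFieldNormedType.Exports.
Local Open Scope classical_set_scope.
Local Open Scope ring_scope.

(* R^n is 'rV[R]_n (normed topology from matrix_normedtype);
   Borel R n is the same carrier equipped with the Borel sigma-algebra
   (sigma-algebra generated by the open sets). *)
Definition Borel (R : realType) (n : nat) :=
  g_sigma_algebraType (@open 'rV[R]_n).

Section defs.
Context {R : realType} {n : nat}.
Local Notation V := 'rV[R]_n.
Local Notation B := (Borel R n).

Definition domain (A : set V) : Prop := open A /\ connected A /\ A !=set0.

Definition boundary (A : set V) : set V := closure A `\` interior A.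

Definition supp (m : {measure set B -> \bar R}) : set V :=
  [set x | forall U : set V, open U -> U x -> (0 < m U)%E].

Definition seq_up_to0 (rs : nat -> R) : Prop :=
  (forall j, rs j < 0) /\ nondecreasing_seq rs /\ rs @ \oo --> 0.

(* {phi_j} (phi_j a function on supp mus_j) has weak limit values phistar
   w.r.t. {mus_j}; Dbar is the closure of D (test functions in C(Dbar)). *)
Definition weak_limit_values (Dbar : set V)
    (mus : nat -> {measure set B -> \bar R}) (phi : nat -> V -> R)
    (m : {measure set B -> \bar R}) (phistar : V -> R) : Prop :=
  m.-integrable (supp m : set B) (fun x : B => (phistar x)%:E) /\
  forall h : V -> R, {within Dbar, continuous h} ->
    (fun j => (\int[mus j]_(x in (supp (mus j) : set B)) (h x * phi j x)%:E)%E)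
      @ \oo --> (\int[m]_(x in (supp m : set B)) (h x * phistar x)%:E)%E.

Definition strong_limit_values (Dbar : set V)
    (mus : nat -> {measure set B -> \bar R}) (phi : nat -> V -> R)
    (m : {measure set B -> \bar R}) (phistar : V -> R) : Prop :=
  measurable_fun (supp m : set B) (phistar : B -> R) /\
  forall a b e d : R, a < b -> 0 < e -> 0 < d ->
    exists j0 : nat, exists O : set V,
      (exists U : set V, open U /\ O = U `&` Dbar) /\
      [set x | supp m x /\ a <= phistar x < b] `<=` O /\
      forall j : nat, (j0 <= j)%N ->
        (mus j ([set x | supp (mus j) x /\ (phi j x < a - e)%R] `&` O)
         + mus j ([set x | supp (mus j) x /\ (b + e < phi j x)%R] `&` O)
         < d%:E)%E.

End defs.

(* Main.v *)
(* Weak convergence of f_j := P_{r_j}(z, .) together with convergence of the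
   squared norms gives, for every bounded continuous h,
     int (f_j - h)^2 dmu_j --> int (f - h)^2 dmu,   f := P(z, .),
   and the limit can be made small because continuous functions are dense in
   L^2(mu). On the open set {a - e/2 < h < b + e/2} Chebyshev's inequality then
   controls {f_j < a - e} and {f_j > b + e}. This open set only misses the part
   of {a <= f < b} where |f - h| >= e/2, which has small mu-measure but has to
   be covered pointwise: since the measures mu_j live on compact subsets of D
   while mu lives on the boundary, it has an open neighbourhood of uniformly
   small mu_j-measure. *)
Require Import Defs.
From HB Require Import structures.
From mathcomp Require Import all_boot all_order all_algebra.
From mathcomp Require Import all_classical all_reals all_analysis.
From mathcomp Require Import measurable_realfun ring lra.
Import Order.TTheory GRing.Theory Num.Theory.
Import numFieldNormedType.Exports.
Set Implicit Arguments.
Unset Strict Implicit.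
Unset Printing Implicit Defensive.
Local Open Scope classical_set_scope.
Local Open Scope ring_scope.

Lemma cvge_near_lt {R : realFieldType} {T : Type} {F : set_system T}
    {FF : Filter F} (u : T -> \bar R) (l m : \bar R) :
  (l < m)%E -> u @ F --> l -> \forall x \near F, (u x < m)%E.
Proof.
move=> lm ul; apply: (ul [set y | (y < m)%E]).
by apply: open_nbhs_nbhs; split => //; exact: open_ereal_lt_ereal.
Qed.

(** * Truncated distance to the complement of a set, and continuous approximations of indicators *)

Section depth.
Context {R : realType} {V : normedModType R}.
Implicit Types (U : set V) (x y : V).

Definition depth_radii U x : set R :=
  [set r | 0 <= r <= 1 /\ ball x r `<=` U].

Definition depth U x : R := sup (depth_radii U x).

Lemma depth_radii0 U x : depth_radii U x 0.
Proof.
split; first by rewrite lexx ler01.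
by move=> y; rewrite -ball_normE /= normr_lt0.
Qed.

Lemma depth_radii_ub U x : ubound (depth_radii U x) 1.
Proof. by move=> r [/andP[]]. Qed.

Lemma depth_radii_le U x r : depth_radii U x r -> r <= depth U x.
Proof. by apply: ub_le_sup; exists 1; exact: depth_radii_ub. Qed.

Lemma depth_ge0 U x : 0 <= depth U x.
Proof. exact/depth_radii_le/depth_radii0. Qed.

(** If the ball of radius r about x lies in U and r > |x - y|, then the ball of radius r - |x - y|
    about y lies in U as well. *)
Lemma depth_lipschitz U x y : depth U x <= depth U y + `|x - y|.
Proof.
apply: ge_sup; first by exists 0; exact: depth_radii0.
move=> r [/andP[r0 r1] rU]; have [rxy|xyr] := leP r `|x - y|.
  by rewrite (le_trans rxy)// lerDr depth_ge0.
rewrite -lerBlDr; apply: depth_radii_le; split.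
  by rewrite subr_ge0 (ltW xyr)/= (le_trans _ r1)// gerBl.
move=> z; rewrite -ball_normE /= => yz; apply: rU; rewrite -ball_normE /=.
by rewrite (le_lt_trans (ler_distD y x z))// addrC -ltrBrDr.
Qed.

Lemma depth_continuous U : continuous (depth U).
Proof.
move=> x; apply/cvgrPdist_lt => e e0; apply/nbhs_ballP; exists e => //= y.
rewrite -ball_normE /=; apply: le_lt_trans.
have := depth_lipschitz U y x; rewrite distrC => yx.
by have xy := depth_lipschitz U x y; rewrite ler_norml; apply/andP; split; lra.
Qed.

Lemma depth_gt0 U x : open U -> U x -> 0 < depth U x.
Proof.
move=> oU Ux; have /nbhs_ballP[e /= e0 eU] := open_nbhs_nbhs (conj oU Ux).
apply: (@lt_le_trans _ _ (Num.min e 1)); first by rewrite lt_min e0 ltr01.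
apply: depth_radii_le; split; first by rewrite le_min (ltW e0) ler01 ge_min lexx orbT.
by move=> y xy; apply: eU; apply: le_ball xy; rewrite ge_min lexx.
Qed.

Lemma depth_eq0 U x : ~ U x -> depth U x = 0.
Proof.
move=> Ux; apply/eqP; rewrite eq_le depth_ge0 andbT.
apply: ge_sup; first by exists 0; exact: depth_radii0.
move=> r [_ rU]; rewrite leNgt; apply/negP => r0; apply: Ux; apply: rU.
exact: ballxx.
Qed.

(** Urysohn-type ramps: continuous, zero off [U], and for open [U] increasing with [k] to the
    indicator of [U]. *)
Definition tent U (k : nat) x : R := Num.min 1 (k.+1%:R * depth U x).

Lemma tent_ge0 U k x : 0 <= tent U k x.
Proof. by rewrite le_min ler01 mulr_ge0// depth_ge0. Qed.

Lemma tent_le1 U k x : tent U k x <= 1.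
Proof. by rewrite ge_min lexx. Qed.

Lemma tent_out U k x : ~ U x -> tent U k x = 0.
Proof. by move=> /depth_eq0 Ux; rewrite /tent Ux mulr0 min_r ?ler01. Qed.

Lemma tent_le_indic U k x : tent U k x <= \1_U x.
Proof.
rewrite indicE; have [xU|/negP xU] := boolP (x \in U); first exact: tent_le1.
by rewrite tent_out// => Ux; apply: xU; rewrite inE.
Qed.

Lemma tent_ndecr U k l x : (k <= l)%N -> tent U k x <= tent U l x.
Proof.
move=> kl; rewrite le_min ge_min lexx /= ge_min; apply/orP; right.
by rewrite ler_wpM2r ?depth_ge0// ler_nat ltnS.
Qed.

Lemma tent_continuous U k : continuous (tent U k).
Proof.
move=> x; apply: (@continuous_min _ _ (cst 1) (fun y => k.+1%:R * depth U y)).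
  exact: cst_continuous.
by apply: continuousM; [exact: cst_continuous|exact: depth_continuous].
Qed.

(** The cap is attained as soon as [k] is at least the inverse of the depth, so the superlevel sets
    of the tents exhaust [U]. *)
Lemma tent_eq1 U x : open U -> U x -> \forall k \near \oo, tent U k x = 1.
Proof.
move=> oU Ux; have d0 := depth_gt0 oU Ux.
near=> k; apply/eqP; rewrite eq_minl// -ler_pdivrMr// mul1r.
have: (depth U x)^-1 <= k%:R by near: k; exact: nbhs_infty_ger.
by move=> /le_trans; apply; rewrite ler_nat.
Unshelve. all: by end_near. Qed.

Lemma tent_cvg U x : open U -> tent U ^~ x @ \oo --> (\1_U x : R).
Proof.
move=> oU; rewrite indicE; have [xU|xU] := boolP (x \in U).
  apply: cvg_near_cst; apply: filterS (tent_eq1 oU (set_mem xU)) => k -> //.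
apply: cvg_near_cst; apply: nearW => k; rewrite tent_out// => Ux.
by move/negP : xU; apply; rewrite inE.
Qed.

End depth.

(** * Borel sets of R^n and outer regularity of finite Borel measures *)

Section borel.
Context {R : realType} {n : nat}.
Local Notation V := 'rV[R]_n.
Local Notation B := (Borel R n).
Implicit Types (U : set V).

Lemma open_borel U : open U -> measurable (U : set B).
Proof. exact: sub_sigma_algebra. Qed.

Lemma closed_borel U : closed U -> measurable (U : set B).
Proof.
move=> /closed_openC/open_borel mU; rewrite -(setCK U).
exact: (@measurableC _ B).
Qed.

Lemma continuous_borel (h : V -> R) :
  continuous h -> measurable_fun [set: B] (h : B -> R).
Proof.
move=> ch; apply: (measurability _ (@measurable_realfun.RGenOpens.measurableE R)).
move=> _ [_ [a [b ->]] <-]; rewrite setTI; apply: open_borel.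
by move/continuousP : ch; apply; exact: interval_open.
Qed.

Section regularity.
Variable mu : {finite_measure set B -> \bar R}.

(* Stated symmetrically in [A] and its complement, so that the class of such
   sets is visibly stable under complementation. *)
Definition regular_set (A : set B) := forall e : R, 0 < e ->
  exists U W : set V, [/\ open U, open W, A `<=` U, ~` A `<=` W &
    (mu (U `&` W : set B) < e%:E)%E].

(** The open sets [W k] of points of depth below 1/(k+1) contain the complement of [U], and they
    meet [U] in sets decreasing to the empty set because the depth is positive on [U]. Continuity
    from above, available for a finite measure, makes one of these sets small. *)
Lemma open_regular U : open U -> regular_set U.
Proof.
move=> oU e e0; pose W k := [set x : V | depth U x < k.+1%:R^-1].
have oW k : open (W k).
  apply: (@open_comp _ _ (depth U) [set r | r < k.+1%:R^-1]).
    by move=> x _; exact: depth_continuous.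
  exact: open_lt.
pose F k : set B := U `&` W k.
have mF k : measurable (F k).
  by apply: open_borel; exact: openI.
have F0 : \bigcap_k F k = set0.
  rewrite -subset0 => x Fx; have [Ux _] := Fx 0%N I.
  have [k _ /(_ k (leqnn _))] := near_infty_natSinv_lt (PosNum (depth_gt0 oU Ux)).
  by have [_ /= /ltW] := Fx k I; rewrite leNgt => /negP.
have : mu \o F @ \oo --> (0 : \bar R)%E.
  rewrite -(measure0 mu) -F0; apply: nonincreasing_cvg_mu => //.
  - by rewrite ltey_eq fin_num_measure.
  - by rewrite F0.
  - move=> k l kl; apply/subsetPset => x [Ux Wx]; split => //.
    by rewrite /W /= (lt_le_trans Wx)// lef_pV2 ?posrE// ler_nat ltnS.
move=> /(cvge_near_lt (e0 : (0 < e%:E)%E))[k _ /(_ k (leqnn _))] Fke.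
exists U, (W k); split => //.
by move=> x nUx; rewrite /W /= depth_eq0// invr_gt0 ltr0n.
Qed.

Lemma regularC (A : set B) : regular_set A -> regular_set (~` A).
Proof.
move=> rA e /rA[U [W [oU oW AU AW UW]]]; exists W, U.
by rewrite setCK setIC.
Qed.

(** The union of the [U k] is open, but the intersection of all the [W k] need not be. Only the
    first [N] are intersected, with [N] so large that the part of the union missed by the first [N]
    sets [U k] has measure below e/2. The intersections of [U k] with [W k] share the other e/2 as a
    geometric series. *)
Lemma regular_bigcup (A : (set B)^nat) :
  (forall k, regular_set (A k)) -> regular_set (\bigcup_k A k).
Proof.
move=> rA e e0.
have e2 : 0 < e / 2 by rewrite divr_gt0.
have ek k : 0 < e / 2 / (2 ^ k.+1)%:R by rewrite divr_gt0// ltr0n expn_gt0.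
have /choice[U' HU'] k := rA k _ (ek k).
have {HU'}/choice[W HUW] := HU'; pose U := U'.
have oU k : open (U k) by have [] := HUW k.
have oW k : open (W k) by have [] := HUW k.
pose T N : set B := \bigcup_k U k `\` \bigcup_(k in `I_N) U k.
have mU : measurable (\bigcup_k U k : set B).
  by apply: open_borel; exact: bigcup_open.
have mT N : measurable (T N).
  apply: (@measurableD _ B) => //; apply: open_borel.
  by apply: bigcup_open => i _.
have T0 : \bigcap_k T k = set0.
  rewrite -subset0 => x Tx; have [[k _ Ukx] _] := Tx 0%N I.
  by have [_] := Tx k.+1 I; apply; exists k => /=.
have : mu \o T @ \oo --> (0 : \bar R)%E.
  rewrite -(measure0 mu) -T0; apply: nonincreasing_cvg_mu => //.
  - by rewrite ltey_eq fin_num_measure.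
  - by rewrite T0.
  - move=> k l kl; apply/subsetPset => x [Ux Wx]; split => //.
    by apply: contra_not Wx => -[i /= ik Uix]; exists i => //=; exact: leq_trans kl.
move=> /(cvge_near_lt (e2 : (0 < (e / 2)%:E)%E))[N _ /(_ N (leqnn _))] TNe.
pose WN : set V := ~` \bigcup_(k in `I_N) ~` W k.
have oWN : open WN.
  apply: closed_openC; apply: closed_bigcup => [|i _]; first exact: finite_II.
  exact: open_closedC.
exists (\bigcup_k U k), WN; split => //.
- exact: bigcup_open.
- by move=> x [k _ Akx]; exists k => //; have [_ _ + _ _] := HUW k; exact.
- move=> x nAx [k /= kN]; apply; have [_ _ _ + _] := HUW k; apply.
  by move=> Akx; apply: nAx; exists k.
pose X : set B := \bigcup_k (U k `&` W k).
have mX : measurable X.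
  by apply: open_borel; apply: bigcup_open => i _; exact: openI.
have muX : (mu X <= (e / 2)%:E)%E.
  apply: (@le_trans _ _ (\sum_(0 <= k <oo) mu (U k `&` W k : set B)))%E.
    apply: generalized_Boole_inequality => // k.
    by apply: open_borel; exact: openI.
  apply: le_trans (epsilon_trick0 xpredT (ltW e2)).
  by apply: lee_nneseries => // k _; have [_ _ _ _ /ltW] := HUW k.
apply: (@le_lt_trans _ _ (mu (X `|` T N))).
  apply: le_measure; rewrite ?inE.
  - by apply: open_borel; apply: openI => //; exact: bigcup_open.
  - exact: measurableU.
  move=> x [[k _ Ukx] WNx].
  have [[i /= iN Uix]|nx] := pselect ((\bigcup_(k in `I_N) U k) x).
    left; exists i => //; split => //.
    by apply: contrapT => nW; apply: WNx; exists i.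
  by right; split => //; exists k.
apply: (le_lt_trans (measureU2 mu mX (mT N))).
by rewrite [e]splitr EFinD; apply: lee_ltD => //; exact: fin_num_measure.
Qed.

(** The regular sets form a sigma-algebra containing the open sets. *)
Lemma measurable_regular (A : set B) : measurable A -> regular_set A.
Proof.
apply: smallest_sub; last exact: open_regular.
split.
- exact: (open_regular open0).
- by move=> X rX; rewrite setTD; exact: regularC.
- exact: regular_bigcup.
Qed.

Lemma outer_regular (A : set B) (e : R) : measurable A -> 0 < e ->
  exists U, [/\ open U, A `<=` U & (mu (U `\` A : set B) < e%:E)%E].
Proof.
move=> mA /(measurable_regular mA)[U [W [oU oW AU AW UWe]]].
exists U; split => //; apply: le_lt_trans UWe; apply: le_measure; rewrite ?inE.
- by apply: (@measurableD _ B) => //; exact: open_borel.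
- by apply: open_borel; exact: openI.
- by move=> x [Ux Ax]; split => //; exact: AW.
Qed.

End regularity.

(** * The complement of the support is a null set *)

Section support.
Variable mu : {measure set B -> \bar R}.

Lemma closed_supp : closed (supp mu).
Proof.
rewrite -(setCK (supp mu)); apply: open_closedC; rewrite openE => x /=.
move=> /existsNP[U /not_implyP[oU /not_implyP[Ux /negP]]].
rewrite -leNgt => U0; apply: filterS (open_nbhs_nbhs (conj oU Ux)) => y Uy.
by move=> /(_ U oU Uy); rewrite ltNge U0.
Qed.

(** Every point outside the support has a null open neighbourhood; compactness leaves finitely many
    of them, so no uncountable union of null sets arises. *)
Lemma compact_setC_supp_null (K : set V) :
  compact K -> K `<=` ~` supp mu -> mu (K : set B) = 0%E.
Proof.
move=> cK KG.
have mK : measurable (K : set B).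
  apply: closed_borel; exact: (compact_closed (@norm_hausdorff _ _)).
move: cK; rewrite compact_cover.
move=> /(_ _ [set U : set V | open U /\ mu (U : set B) = 0%E] id).
case=> [U []//|x /KG|F Fnull KF].
  move=> /existsNP[U /not_implyP[oU /not_implyP[Ux /negP]]].
  rewrite -leNgt => U0; exists U => //; split => //.
  by apply/eqP; rewrite eq_le U0 measure_ge0.
have [mF F0] : measurable (\big[setU/set0]_(U <- finmap.enum_fset F) U : set B) /\
    mu (\big[setU/set0]_(U <- finmap.enum_fset F) U : set B) = 0%E.
  have : forall U, U \in finmap.enum_fset F -> open U /\ mu (U : set B) = 0%E.
    by move=> U UF; have := Fnull _ UF; rewrite inE.
  elim: (finmap.enum_fset F) => [_|U s IH Us]; first by rewrite !big_nil measure0.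
  have [mV V0] := IH (fun W Ws => Us W (@mem_behead _ (U :: s) _ Ws)).
  have [/open_borel mU U0] := Us _ (mem_head _ _).
  by rewrite !big_cons; split; [exact: measurableU|exact: null_set_setU].
apply/eqP; rewrite eq_le measure_ge0 andbT -F0 le_measure ?inE//.
by move: KF; rewrite /cover bigcup_fset.
Qed.

(** The open complement of the support is a countable union of compact sets, namely the points of
    norm at most [k] and depth at least 1/(k+1): closed bounded sets are compact in finite
    dimension. Each of them is null. *)
Lemma setC_supp_null : mu (~` supp mu : set B) = 0%E.
Proof.
have oG : open (~` supp mu) by exact/closed_openC/closed_supp.
pose K k := [set x : V | `|x| <= k%:R] `&`
            [set x : V | k.+1%:R^-1 <= depth (~` supp mu) x].
have clK k : closed (K k).
  apply: closedI.
    apply: (@preimage_closed _ _ (fun x : V => `|x|) [set r | r <= k%:R]).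
      by move=> x _; exact: norm_continuous.
    exact: closed_le.
  apply: (@preimage_closed _ _ (depth (~` supp mu)) [set r | k.+1%:R^-1 <= r]).
    by move=> x _; exact: depth_continuous.
  exact: closed_ge.
have K0 k : mu (K k : set B) = 0%E.
  apply: compact_setC_supp_null.
    apply: bounded_closed_compact => //; exists k%:R; split => //.
    by move=> r kr x [/= xk _]; rewrite (le_trans xk)// ltW.
  move=> x [_ /= xd]; apply: contrapT => Gx; move: xd.
  by rewrite depth_eq0// leNgt invr_gt0 ltr0n.
have KE : ~` supp mu `<=` \bigcup_k K k.
  move=> x Gx; have d0 := depth_gt0 oG Gx.
  have [k [k1 k2]] : exists k : nat, (depth (~` supp mu) x)^-1 <= k%:R /\ `|x| <= k%:R.
    near \oo => k; exists k; split; near: k; exact: nbhs_infty_ger.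
  exists k => //; split => //=; rewrite -(invrK (depth _ _)) lef_pV2 ?posrE ?invr_gt0//.
  by rewrite (le_trans k1)// ler_nat.
apply/eqP; rewrite eq_le measure_ge0 andbT.
apply: (@le_trans _ _ (\sum_(0 <= k <oo) mu (K k : set B)))%E.
  apply: measure_sigma_subadditive => // [k|]; first exact: closed_borel.
  exact: open_borel.
by rewrite eseries0.
Unshelve. all: by end_near. Qed.

End support.
End borel.

(** * Square integrals: inequalities and dominated convergence *)

Section square_integrals.
Context {d : measure_display} {T : measurableType d} {R : realType}.
Variable mu : {measure set T -> \bar R}.
Implicit Types f g h : T -> R.

Lemma measurable_norm_ge f (c : R) : measurable_fun [set: T] f ->
  measurable [set x | c <= `|f x|].
Proof.
move=> mf; rewrite -[X in measurable X]setTI.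
rewrite (_ : [set x | _] = (fun x => `|f x|) @^-1` `[c, +oo[%classic); last first.
  by apply/seteqP; split => x /=; rewrite in_itv/= andbT.
by have /(_ measurableT) := measurableT_comp (@normr_measurable R setT) mf; apply.
Qed.

Lemma measurable_EFin_sqr f : measurable_fun [set: T] f ->
  measurable_fun [set: T] (fun x => (f x ^+ 2)%:E : \bar R).
Proof. by move=> mf; apply/measurable_EFinP; exact: measurable_funX. Qed.

Lemma sqr_integral_ge0 f : (0 <= \int[mu]_x (f x ^+ 2)%:E)%E.
Proof. by apply: integral_ge0 => x _; rewrite lee_fin sqr_ge0. Qed.

Lemma le_sqr_integral f g :
  measurable_fun [set: T] f -> measurable_fun [set: T] g ->
  (forall x, `|f x| <= `|g x|) ->
  (\int[mu]_x (f x ^+ 2)%:E <= \int[mu]_x (g x ^+ 2)%:E)%E.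
Proof.
move=> mf mg fg; apply: ge0_le_integral => //.
- by move=> x _; rewrite lee_fin sqr_ge0.
- exact: measurable_EFin_sqr.
- exact: measurable_EFin_sqr.
- by move=> x _; rewrite lee_fin -(real_normK (num_real (f x)))
    -(real_normK (num_real (g x))) lerXn2r// nnegrE.
Qed.

(** From (f + g)^2 <= 2 f^2 + 2 g^2. It takes the place of the triangle inequality in L^2 and avoids
    square roots. *)
Lemma sqr_integralD_le f g :
  measurable_fun [set: T] f -> measurable_fun [set: T] g ->
  (\int[mu]_x ((f x + g x) ^+ 2)%:E <=
   2%:E * \int[mu]_x (f x ^+ 2)%:E + 2%:E * \int[mu]_x (g x ^+ 2)%:E)%E.
Proof.
move=> mf mg; rewrite -!ge0_integralZl//; first last.
- by move=> x _; rewrite lee_fin sqr_ge0.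
- exact: measurable_EFin_sqr.
- by move=> x _; rewrite lee_fin sqr_ge0.
- exact: measurable_EFin_sqr.
rewrite -ge0_integralD//; first last.
- by apply: measurable_funeM; exact: measurable_EFin_sqr.
- by move=> x _; rewrite -EFinM lee_fin mulr_ge0// sqr_ge0.
- by apply: measurable_funeM; exact: measurable_EFin_sqr.
- by move=> x _; rewrite -EFinM lee_fin mulr_ge0// sqr_ge0.
apply: ge0_le_integral => //.
- by move=> x _; rewrite lee_fin sqr_ge0.
- by apply: measurable_EFin_sqr; exact: measurable_funD.
- by apply: emeasurable_funD; apply: measurable_funeM; exact: measurable_EFin_sqr.
- move=> x _; rewrite -!EFinM -EFinD lee_fin.
  by have := sqr_ge0 (f x - g x); nra.
Qed.

Lemma sqr_integralD_lt f g (e : R) :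
  measurable_fun [set: T] f -> measurable_fun [set: T] g ->
  (\int[mu]_x (f x ^+ 2)%:E < (e / 4)%:E)%E ->
  (\int[mu]_x (g x ^+ 2)%:E < (e / 4)%:E)%E ->
  (\int[mu]_x ((f x + g x) ^+ 2)%:E < e%:E)%E.
Proof.
move=> mf mg fe ge; apply: (le_lt_trans (sqr_integralD_le mf mg)).
have -> : e%:E = (2%:E * (e / 4)%:E + 2%:E * (e / 4)%:E)%E.
  by rewrite -!EFinM -EFinD; congr EFin; field.
by apply: lteD; rewrite lte_pmul2l.
Qed.

(** Used twice: for tents, with errors dominated by the constant 1, and for simple functions below a
    non-negative [f], with errors dominated by [f] itself. *)
Lemma sqr_integral_dct (f_ : nat -> T -> R) f g (e : R) :
  (forall k, measurable_fun [set: T] (f_ k)) -> measurable_fun [set: T] f ->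
  measurable_fun [set: T] g ->
  (forall x, f_ ^~ x @ \oo --> f x) -> (forall k x, `|f x - f_ k x| <= g x) ->
  (\int[mu]_x (g x ^+ 2)%:E < +oo)%E -> 0 < e ->
  exists k, (\int[mu]_x ((f x - f_ k x) ^+ 2)%:E < e%:E)%E.
Proof.
move=> mf_ mf mg f_f f_g g2 e0.
have cvg_sqr : {ae mu, forall x, [set: T] x ->
    (fun k => ((f x - f_ k x) ^+ 2)%:E) @ \oo --> 0%E}.
  apply: aeW => x _; apply: cvg_EFin; first exact: nearW.
  have fx : (fun k => f x - f_ k x) @ \oo --> (0 : R).
    rewrite -[X in _ --> X](subrr (f x)).
    by apply: cvgB; [exact: cvg_cst|exact: f_f].
  rewrite -[X in _ --> X](mulr0 0).
  by under eq_fun do rewrite /= expr2; exact: cvgM.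
have ig : mu.-integrable [set: T] (fun x => (g x ^+ 2)%:E).
  apply/integrableP; split; first exact: measurable_EFin_sqr.
  by under eq_integral do rewrite gee0_abs ?lee_fin ?sqr_ge0//.
have dom : {ae mu, forall x k, [set: T] x ->
    (`|((f x - f_ k x) ^+ 2)%:E| <= (g x ^+ 2)%:E)%E}.
  apply: aeW => x k _; rewrite gee0_abs ?lee_fin ?sqr_ge0//.
  rewrite -(real_normK (num_real (f x - _))) lerXn2r// ?nnegrE//.
  by rewrite (le_trans _ (f_g k x)).
have [_ _] := dominated_convergence measurableT
  (fun k => measurable_EFin_sqr (measurable_funB mf (mf_ k)))
  (measurable_cst _) cvg_sqr ig dom.
rewrite integral0 => /(cvge_near_lt (e0 : (0 < e%:E)%E))[k _ /(_ k (leqnn _)) ke].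
by exists k.
Qed.

End square_integrals.

(** * Density of the bounded continuous functions in L^2 of a finite Borel measure *)

Section density.
Context {R : realType} {n : nat}.
Local Notation V := 'rV[R]_n.
Local Notation B := (Borel R n).
Variable mu : {finite_measure set B -> \bar R}.

Implicit Types (f g : B -> R) (h : V -> R) (c e : R).

(** Test functions on the whole space; boundedness makes them integrable against every finite
    measure. *)
Definition bounded_continuous (h : V -> R) :=
  continuous h /\ exists M, forall x, `|h x| <= M.

Lemma bounded_continuousD (g h : V -> R) :
  bounded_continuous g -> bounded_continuous h ->
  bounded_continuous (fun x => g x + h x).
Proof.
move=> [cg [M gM]] [ch [N hN]]; split.
  by move=> x; apply: continuousD; [exact: cg|exact: ch].
by exists (M + N) => x; rewrite (le_trans (ler_normD _ _))// lerD.
Qed.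

Lemma bounded_continuousZ c h : bounded_continuous h ->
  bounded_continuous (fun x => c * h x).
Proof.
move=> [ch [M hM]]; split.
  by move=> x; apply: continuousM; [exact: cst_continuous|exact: ch].
by exists (`|c| * M) => x; rewrite normrM ler_wpM2l.
Qed.

Lemma bounded_continuous_tent (U : set V) k : bounded_continuous (tent U k).
Proof.
split; first exact: tent_continuous.
by exists 1 => x; rewrite ger0_norm ?tent_ge0// tent_le1.
Qed.

(** Membership in the L^2 closure of the bounded continuous functions, expressed through squared
    distances. *)
Definition approximable (f : B -> R) := measurable_fun [set: B] f /\
  forall e, 0 < e -> exists2 h : V -> R, bounded_continuous h &
    (\int[mu]_x ((f x - h x) ^+ 2)%:E < e%:E)%E.

Lemma bounded_continuous_measurable (h : V -> R) :
  bounded_continuous h -> measurable_fun [set: B] (h : B -> R).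
Proof. by case=> /continuous_borel. Qed.

Lemma approximable_bounded_continuous (h : V -> R) :
  bounded_continuous h -> approximable h.
Proof.
move=> bh; split; first exact: bounded_continuous_measurable.
move=> e e0; exists h => //; under eq_integral do rewrite subrr expr0n/=.
by rewrite integral0 lte_fin.
Qed.

Lemma approximable_lim f : measurable_fun [set: B] f ->
  (forall e, 0 < e -> exists2 g, approximable g &
    (\int[mu]_x ((f x - g x) ^+ 2)%:E < e%:E)%E) ->
  approximable f.
Proof.
move=> mf fg; split => // e e0; have e4 : 0 < e / 4 by rewrite divr_gt0.
have [g [mg ag] fge] := fg _ e4; have [h bh gh] := ag _ e4; exists h => //.
have mh := bounded_continuous_measurable bh.
under eq_integral => x _.
  rewrite (_ : f x - h x = (f x - g x) + (g x - h x)); last by ring.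
  over.
by apply: (@sqr_integralD_lt _ _ _ mu (fun x => f x - g x) (fun x => g x - h x)) => //;
  exact: measurable_funB.
Qed.

Lemma approximableD f g :
  approximable f -> approximable g -> approximable (fun x => f x + g x).
Proof.
move=> [mf af] [mg ag]; split; first exact: measurable_funD.
move=> e e0; have e4 : 0 < e / 4 by rewrite divr_gt0.
have [u bu fu] := af _ e4; have [v bv gv] := ag _ e4.
have mu' := bounded_continuous_measurable bu.
have mv := bounded_continuous_measurable bv.
exists (fun x => u x + v x); first exact: bounded_continuousD.
under eq_integral => x _.
  rewrite (_ : f x + g x - _ = (f x - u x) + (g x - v x)); last by ring.
  over.
by apply: (@sqr_integralD_lt _ _ _ mu (fun x => f x - u x) (fun x => g x - v x)) => //;
  exact: measurable_funB.
Qed.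

Lemma approximableZ c f : approximable f -> approximable (fun x => c * f x).
Proof.
move=> [mf af]; split; first exact: measurable_funM.
(* Dividing by c^2 + 1 rather than by c^2 covers the case c = 0. *)
move=> e e0; have c0 : 0 < c ^+ 2 + 1 by rewrite ltr_wpDl// sqr_ge0.
have [h bh fh] := af _ (divr_gt0 e0 c0).
have mh := bounded_continuous_measurable bh.
exists (fun x => c * h x); first exact: bounded_continuousZ.
under eq_integral do rewrite -mulrBr exprMn EFinM.
have mfh := measurable_EFin_sqr (measurable_funB mf mh).
rewrite ge0_integralZl ?lee_fin ?sqr_ge0//; last first.
  by move=> x _; rewrite lee_fin sqr_ge0.
apply: (@le_lt_trans _ _ ((c ^+ 2 + 1)%:E * \int[mu]_x ((f x - h x) ^+ 2)%:E))%E.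
  by apply: lee_wpmul2r; rewrite ?sqr_integral_ge0// lee_fin lerDl.
move: fh; rewrite -(@lte_pmul2l _ (c ^+ 2 + 1)%:E)// -EFinM.
by rewrite mulrCA divff ?mulr1// gt_eqF.
Qed.

Lemma approximable_sum (I : eqType) (s : seq I) (F : I -> B -> R) :
  (forall i, approximable (F i)) -> approximable (fun x => \sum_(i <- s) F i x).
Proof.
move=> aF; elim: s => [|i s IH].
  under eq_fun do rewrite big_nil.
  apply: approximable_bounded_continuous; split; first exact: cst_continuous.
  by exists 0 => x; rewrite normr0.
by under eq_fun do rewrite big_cons; exact: approximableD.
Qed.

(** The tents converge pointwise to the indicator with errors at most 1, and constants are square
    integrable for a finite measure. *)
Lemma approximable_indic_open (U : set V) :
  open U -> approximable (\1_U : B -> R).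
Proof.
move=> oU; have mU : measurable_fun [set: B] (\1_U : B -> R).
  exact: measurable_indic (open_borel oU).
apply: approximable_lim => // e e0.
have b0 x : 0 <= (\1_U x : R) <= 1.
  by rewrite indicE; case: (x \in U); rewrite ?lexx ?ler01.
have U1 : (\int[mu]_(x in [set: B]) (cst 1 x ^+ 2)%:E < +oo)%E.
  under eq_integral do rewrite expr1n.
  by rewrite integral_cst// mul1e ltey_eq fin_num_measure.
have tU k x : `|(\1_U x : R) - tent U k x| <= cst 1 x.
  have := tent_ge0 U k x; have := tent_le_indic U k x; have := b0 x.
  by rewrite ler_norml /= => /andP[]; lra.
have [k ke] := sqr_integral_dct
  (fun k => bounded_continuous_measurable (bounded_continuous_tent U k))
  mU (measurable_cst _) (fun x => tent_cvg oU) tU U1 e0.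
exists (tent U k) => //; apply: approximable_bounded_continuous.
exact: bounded_continuous_tent.
Qed.

(** By outer regularity [A] lies in an open [U] that exceeds it by a set of small measure. The
    squared difference of the two indicators is the indicator of that set. *)
Lemma approximable_indic (A : set B) :
  measurable A -> approximable (\1_A : B -> R).
Proof.
move=> mA; apply: approximable_lim => [|e e0]; first exact: measurable_indic.
have [U [oU AU UAe]] := outer_regular mu mA e0.
exists (\1_U); first exact: approximable_indic_open.
under eq_integral => x _.
  rewrite (_ : (_ ^+ 2) = \1_(U `\` A : set B) x); last first.
    rewrite !indicE in_setD; have [xA|xA] := boolP (x \in A).
      by rewrite (mem_set (AU _ (set_mem xA))) subrr expr0n/=.
    by case: (x \in U); rewrite /= ?subr0 ?sub0r ?sqrrN ?expr1n ?expr0n.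
  over.
rewrite integral_indic// ?setIT//.
by apply: (@measurableD _ B) => //; exact: open_borel.
Qed.

Import HBNNSimple.

Lemma approximable_nnsfun (s : {nnsfun B >-> R}) : approximable s.
Proof.
rewrite (_ : (s : B -> R) = fun x =>
    \sum_(y <- finmap.enum_fset (fset_set (range s)))
    y * \1_(s @^-1` [set y]) x); last first.
  by apply/funext => x; rewrite fimfunE fsbig_finite.
apply: approximable_sum => y; apply: approximableZ; apply: approximable_indic.
exact: measurable_funPTI.
Qed.

(** Simple functions increase to [f], so the error lies between 0 and [f], and [f] is a square
    integrable dominating function. *)
Lemma approximable_ge0 f : (forall x, 0 <= f x) ->
  measurable_fun [set: B] f -> (\int[mu]_x (f x ^+ 2)%:E < +oo)%E ->
  approximable f.
Proof.
move=> f0 mf f2; apply: approximable_lim => // e e0.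
have mEf : measurable_fun [set: B] (fun x => (f x)%:E) by exact/measurable_EFinP.
pose s := nnsfun_approx measurableT mEf.
have sf x : s ^~ x @ \oo --> f x.
  have := cvg_nnsfun_approx measurableT mEf (fun y _ => f0 y) (x := x) I.
  by move=> /fine_cvgP[].
have sle k x : s k x <= f x.
  rewrite -lee_fin nnsfun_approxE.
  exact: (@le_approx _ _ _ setT (fun y => (f y)%:E) k x (fun y _ => f0 y) I).
have sfk k x : `|f x - s k x| <= f x.
  by rewrite ger0_norm ?subr_ge0// gerBl.
have [k ke] := sqr_integral_dct (fun k => measurable_funPT (s k))
  mf mf sf sfk f2 e0.
by exists (s k) => //; exact: approximable_nnsfun.
Qed.

Lemma approximable_L2 f :
  measurable_fun [set: B] f -> (\int[mu]_x (f x ^+ 2)%:E < +oo)%E ->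
  approximable f.
Proof.
move=> mf f2.
have part g : (forall x, 0 <= g x) -> measurable_fun [set: B] g ->
    (forall x, g x <= `|f x|) -> approximable g.
  move=> g0 mg gf; apply: approximable_ge0 => //; apply: le_lt_trans f2.
  by apply: le_sqr_integral => // x; rewrite ger0_norm.
rewrite (_ : f = fun x => f^\+ x + (-1) * f^\- x); last first.
  apply/funext => x; rewrite /funrpos /funrneg !maxEle.
  by case: leP => ?; case: leP => ?; lra.
apply: approximableD; last apply: approximableZ; apply: part => //.
- exact: measurable_funrpos.
- by move=> x; rewrite /funrpos ge_max ler_norm normr_ge0.
- exact: measurable_funrneg.
- by move=> x; rewrite /funrneg ge_max -normrN ler_norm normr_ge0.
Qed.

End density.

(** * Expansion of the squared distance to a test function, and Chebyshev's inequality *)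

Section square_expansion.
Context {R : realType} {n : nat}.
Local Notation V := 'rV[R]_n.
Local Notation B := (Borel R n).
Variable mu : {finite_measure set B -> \bar R}.
Implicit Types (f : B -> R) (h : V -> R).

Lemma sqr_integrable f : measurable_fun [set: B] f ->
  (\int[mu]_x (f x ^+ 2)%:E < +oo)%E ->
  mu.-integrable [set: B] (fun x => (f x ^+ 2)%:E).
Proof.
move=> mf f2; apply/integrableP; split; first exact: measurable_EFin_sqr.
by under eq_integral do rewrite gee0_abs ?lee_fin ?sqr_ge0//.
Qed.

Lemma bounded_continuousX2 h : bounded_continuous h ->
  bounded_continuous (fun x => h x ^+ 2).
Proof.
move=> [ch [M hM]]; split.
  by move=> x; apply: continuousM; exact: ch.
by exists (M ^+ 2) => x; rewrite normrX lerXn2r ?nnegrE// (le_trans _ (hM x)).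
Qed.

Lemma bounded_continuous_integrable h : bounded_continuous h ->
  mu.-integrable [set: B] (fun x => (h x)%:E).
Proof.
move=> bh; have mh := bounded_continuous_measurable bh.
have [_ [M hM]] := bh.
apply: (le_integrable measurableT _ _
  (finite_measure_integrable_cst mu M measurableT)).
  exact/measurable_EFinP.
by move=> x _ /=; rewrite lee_fin (le_trans (hM x))// ler_norm.
Qed.

(** Separates the squared distance into the terms governed by convergence of the norms, by weak
    limit values and by weak convergence of the measures. *)
Lemma sqr_integralB f h : measurable_fun [set: B] f ->
  (\int[mu]_x (f x ^+ 2)%:E < +oo)%E -> bounded_continuous h ->
  (\int[mu]_x ((f x - h x) ^+ 2)%:E = \int[mu]_x (f x ^+ 2)%:E +
    ((-2)%:E * \int[mu]_x (h x * f x)%:E + \int[mu]_x (h x ^+ 2)%:E))%E.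
Proof.
move=> mf f2 bh.
have mh := bounded_continuous_measurable bh.
have if2 := sqr_integrable mf f2.
have ih2 := bounded_continuous_integrable (bounded_continuousX2 bh).
(* The cross term is integrable because |hf| <= f^2 + h^2. *)
have ihf : mu.-integrable [set: B] (fun x => (h x * f x)%:E).
  apply: (le_integrable measurableT _ _ (integrableD measurableT if2 ih2)).
    by apply/measurable_EFinP; exact: measurable_funM.
  move=> x _; rewrite /= lee_fin (le_trans _ (ler_norm _))//.
  by rewrite ler_norml; apply/andP; split; nra.
rewrite -integralZl// -integralD//; last exact: integrableZl.
rewrite -integralD//; last by apply: integrableD => //; exact: integrableZl.
by apply: eq_integral => x _; rewrite -EFinM -!EFinD; congr EFin; ring.
Qed.

Lemma sqr_markov f (e c : R) : measurable_fun [set: B] f -> 0 < e ->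
  (\int[mu]_x (f x ^+ 2)%:E < (e ^+ 2 * c)%:E)%E ->
  (mu [set x | e <= `|f x|]%R < c%:E)%E.
Proof.
move=> mf e0; have e20 : 0 < e ^+ 2 by rewrite exprn_gt0.
have := @le_integral_abse _ _ _ mu _ measurableT _ _ (measurable_EFin_sqr mf) e20.
under eq_integral do rewrite gee0_abs ?lee_fin ?sqr_ge0//.
rewrite setTI => /le_lt_trans /[apply]; rewrite (EFinM (e ^+ 2)) lte_pmul2l//.
rewrite (_ : [set x | _] = [set x | e <= `|f x|])//.
by apply/seteqP; split => x /=; rewrite lee_fin (ger0_norm (sqr_ge0 (f x)))
  -(real_normK (num_real (f x))) ler_pXn2r// nnegrE ltW.
Qed.

End square_expansion.

(** * Strong limit values for measures [mus j] carried by increasing closed sets [K j] *)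

Section strong_limits.
Context {R : realType} {n : nat}.
Local Notation V := 'rV[R]_n.
Local Notation B := (Borel R n).
Variables (mus : nat -> {finite_measure set B -> \bar R})
  (mu : {finite_measure set B -> \bar R}).
Variable K : nat -> set V.
Hypothesis closedK : forall j, closed (K j).
Hypothesis ndK : forall i j, (i <= j)%N -> K i `<=` K j.
Hypothesis musK : forall j, mus j (~` K j : set B) = 0%E.
Hypothesis weak_cvg : forall h : V -> R, bounded_continuous h ->
  (fun j => \int[mus j]_x (h x)%:E)%E @ \oo --> (\int[mu]_x (h x)%:E)%E.

(* Weak convergence bounds [mus j O] for an open [O] only from below. Here an
   upper bound uniform in [j] is possible because [A] avoids every [K j]: the
   [m]-th piece of [O] is removed from [K (J m)], so that it is charged only by
   the measures [mus j] with [j > J m], which already integrate [tent U m] to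
   almost the same value as [mu]. *)
Lemma small_open_cover (A : set B) (d : R) : measurable A ->
  (forall j, A `&` K j = set0) -> 0 < d -> (mu A < d%:E)%E ->
  exists O : set V, [/\ open O, A `<=` O &
    forall j, (mus j (O : set B) <= (4 * d)%:E)%E].
Proof.
move=> mA AK d0 Ad.
have [U [oU AU UAd]] := outer_regular mu mA d0.
have mU := open_borel oU.
have Ud : (mu (U : set B) < (2 * d)%:E)%E.
  rewrite -(setDUK AU); apply: (le_lt_trans (measureU2 mu mA _)).
    exact: (@measurableD _ B).
  by rewrite mulrDl mul1r EFinD; exact: lteD.
(* The requirement [m <= j0] gives [m <= J m]. Hence only finitely many [m] satisfy [J m < j], and a
   largest one can be chosen below. *)
have /choice[J HJ] m : exists j0, (m <= j0)%N /\
    forall j, (j0 <= j)%N -> (\int[mus j]_x (tent U m x)%:E < (2 * d)%:E)%E.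
  have : (\int[mu]_x (tent U m x)%:E < (2 * d)%:E)%E.
    apply: le_lt_trans Ud.
    have <- : (\int[mu]_x (\1_(U : set B) x)%:E = mu (U : set B))%E.
      by rewrite integral_indic// setIT.
    apply: ge0_le_integral => //.
    - by move=> x _; rewrite lee_fin tent_ge0.
    - apply/measurable_EFinP; apply: bounded_continuous_measurable.
      exact: bounded_continuous_tent.
    - by apply/measurable_EFinP; exact: measurable_indic.
    - by move=> x _; rewrite lee_fin tent_le_indic.
  move=> /cvge_near_lt /(_ (weak_cvg (bounded_continuous_tent U m)))[j0 _ j0P].
  exists (maxn m j0); split; first exact: leq_maxl.
  by move=> j; rewrite geq_max => /andP[_ /j0P].
(* A strict level below 1 keeps [G m] open, while every point of [A] still enters it for large [m].
   Chebyshev's inequality at level 1/2 turns the bound 2d into 4d. *)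
pose G m : set V := [set x | 1 / 2 < tent U m x].
have oG m : open (G m).
  apply: (@open_comp _ _ (tent U m) [set r | 1 / 2 < r]).
    by move=> x _; exact: tent_continuous.
  exact: open_gt.
pose O := \bigcup_m (G m `\` K (J m)).
have oO : open O.
  by apply: bigcup_open => m _; apply: openI => //; exact: closed_openC.
exists O; split => //.
  move=> x Ax; have [m _ /(_ m (leqnn _)) m1] := tent_eq1 oU (AU _ Ax).
  exists m => //; split; first by rewrite /G /= m1; lra.
  by move=> Kx; have : (A `&` K (J m)) x by []; rewrite AK.
move=> j.
have mK : measurable (K j : set B) := closed_borel (@closedK j).
have mO := open_borel oO.
have OK : mus j (O : set B) = mus j (O `&` K j : set B).
  rewrite -[RHS]add0e (measureDI (mus j) mO mK); congr (_ + _)%E.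
  apply: subset_measure0 (musK j).
  - exact: (@measurableD _ B).
  - exact: (@measurableC _ B).
  - by move=> x [].
rewrite OK.
(* If no [m] has [J m < j], each piece of [O] has lost a set [K (J m)] containing [K j], so [O]
   misses [K j]. *)
have [[m Jm]|noJ] := pselect (exists m, (J m < j)%N); last first.
  rewrite (_ : O `&` K j = set0) ?measure0 ?lee_fin; first by lra.
  rewrite -subset0 => x [[m _ [_ nK]] Kx]; apply: nK; apply: ndK Kx.
  by rewrite leqNgt; apply/negP => Jm; apply: noJ; exists m.
(* Pieces with [J i >= j] miss [K j], and the tents increase with their index, so [O] meets [K j]
   only where [tent U M] exceeds 1/2. *)
have [M JM maxM] : exists2 M, (J M < j)%N & forall i, (J i < j)%N -> (i <= M)%N.
  have ex : exists m, (fun m => J m < j)%N m by exists m.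
  have ub i : (fun m => J m < j)%N i -> (i <= j)%N.
    by move=> /ltnW; apply: leq_trans; have [] := HJ i.
  by case: (ex_maxnP ex ub) => M; exists M.
have mtent : measurable_fun [set: B] (fun x : B => (tent U M x)%:E).
  apply/measurable_EFinP; apply: bounded_continuous_measurable.
  exact: bounded_continuous_tent.
have := @le_integral_abse _ _ _ (mus j) _ measurableT _ (1 / 2) mtent ltac:(lra).
under eq_integral do rewrite gee0_abs ?lee_fin ?tent_ge0//.
move=> tentM; have [_ /(_ j (ltnW JM)) tent_lt] := HJ M.
have := le_lt_trans tentM tent_lt.
rewrite (_ : (2 * d)%:E = ((1 / 2)%:E * (4 * d)%:E)%E); last first.
  by rewrite -EFinM; congr EFin; field.
rewrite lte_pmul2l ?lte_fin; [|by []|by lra]; move=> /ltW; apply: le_trans.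
apply: le_measure; rewrite ?inE.
- exact: measurableI.
- apply: measurableI => //; apply: (measurable_norm_ge (f := tent U M : B -> R)).
  exact: (bounded_continuous_measurable (bounded_continuous_tent U M)).
- move=> x [[i _ [Gi nK]] Kx]; split => //=.
  rewrite lee_fin (ger0_norm (tent_ge0 _ _ _)).
  rewrite (le_trans (ltW Gi))// tent_ndecr// maxM// ltnNge; apply/negP => jJ.
  by apply: nK; apply: ndK Kx.
Qed.

Variables (f_ : nat -> B -> R) (f : B -> R).
Hypothesis mf_ : forall j, measurable_fun [set: B] (f_ j).
Hypothesis mf : measurable_fun [set: B] f.
Hypothesis weak_f : forall h : V -> R, bounded_continuous h ->
  (fun j => \int[mus j]_x (h x * f_ j x)%:E)%E @ \oo -->
  (\int[mu]_x (h x * f x)%:E)%E.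
Hypothesis sqr_f : 
  (fun j => \int[mus j]_x (f_ j x ^+ 2)%:E)%E @ \oo --> (\int[mu]_x (f x ^+ 2)%:E)%E.
Hypothesis sqr_f_fin : (\int[mu]_x (f x ^+ 2)%:E < +oo)%E.

Lemma cvg_sqr_integralB (h : V -> R) : bounded_continuous h ->
  (fun j => \int[mus j]_x ((f_ j x - h x) ^+ 2)%:E)%E @ \oo -->
  (\int[mu]_x ((f x - h x) ^+ 2)%:E)%E.
Proof.
move=> bh; rewrite sqr_integralB//.
have fin2 (m : {finite_measure set B -> \bar R}) g : bounded_continuous g ->
    (\int[m]_x (g x)%:E)%E \is a fin_num.
  move=> /(bounded_continuous_integrable m).
  exact: (integrable_fin_num measurableT).
have lim_fin : (\int[mu]_x (f x ^+ 2)%:E)%E \is a fin_num.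
  by rewrite ge0_fin_numE// sqr_integral_ge0.
have cvg_rhs : (fun j => \int[mus j]_x (f_ j x ^+ 2)%:E +
    ((-2)%:E * \int[mus j]_x (h x * f_ j x)%:E + \int[mus j]_x (h x ^+ 2)%:E))%E
    @ \oo --> (\int[mu]_x (f x ^+ 2)%:E +
    ((-2)%:E * \int[mu]_x (h x * f x)%:E + \int[mu]_x (h x ^+ 2)%:E))%E.
  apply: (cvgeD _ sqr_f); first exact: fin_num_adde_defr.
  apply: cvgeD; last exact: weak_cvg (bounded_continuousX2 bh).
    exact/fin_num_adde_defl/fin2/bounded_continuousX2.
  by apply: cvgeZl; [by []|exact: weak_f].
(* The expansion for [mus j] requires [f_ j] to be square integrable; this holds for large [j]
   because the limit of the square integrals is finite. *)
apply: cvg_trans cvg_rhs; apply: near_eq_cvg; near=> j.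
rewrite sqr_integralB//; near: j; exact: cvge_near_lt sqr_f_fin sqr_f.
Unshelve. all: by end_near. Qed.

(** The set [S] stands for the boundary of the domain. Its disjointness from all [K j] is what
    allows the points of [S] where [f] is far from its approximation to be covered by a set of small
    [mus j]-measure. *)
Lemma strong_limit (S : set B) (a b e d : R) : measurable S ->
  (forall j, S `&` K j = set0) -> 0 < e -> 0 < d ->
  exists (j0 : nat) (O : set V), [/\ open O,
    [set x | S x /\ a <= f x < b] `<=` O &
    forall j, (j0 <= j)%N ->
      (mus j ([set x | (f_ j x < a - e)%R] `&` O : set B)
       + mus j ([set x | (b + e < f_ j x)%R] `&` O : set B) < d%:E)%E].
Proof.
move=> mS SK e0 d0.
have e20 : 0 < e / 2 by rewrite divr_gt0.
(* Chebyshev's inequality at level e/2 turns this bound into d/16. [small_open_cover] costs a factor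
   4, so the cover of the bad set has [mus j]-measure at most d/4. With d/16 < d/4 from Chebyshev's
   inequality for [mus j], each of the two sets stays below d/2. *)
have [h bh] := (approximable_L2 mf sqr_f_fin).2 ((e / 2) ^+ 2 * (d / 16))
  (mulr_gt0 (exprn_gt0 2 e20) (divr_gt0 d0 (ltr0n _ 16))).
move=> fh; have [ch _] := bh; have mh := bounded_continuous_measurable bh.
pose Bad : set B := S `&` [set x | e / 2 <= `|f x - h x|].
have mge (g : B -> R) : measurable_fun [set: B] g ->
    measurable [set x : B | e / 2 <= `|g x|].
  exact: measurable_norm_ge.
have mBad : measurable Bad.
  by apply: measurableI => //; exact: mge (measurable_funB mf mh).
have Bad_small : (mu Bad < (d / 16)%:E)%E.
  apply: le_lt_trans (sqr_markov (measurable_funB mf mh) e20 fh).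
  apply: le_measure; rewrite ?inE//; last exact: subIsetr.
  exact: mge (measurable_funB mf mh).
have [W [oW BadW Wd]] : exists O : set V, [/\ open O, Bad `<=` O &
    forall j, (mus j (O : set B) <= (4 * (d / 16))%:E)%E].
  apply: small_open_cover => //; last by rewrite divr_gt0.
  by move=> j; rewrite /Bad -setIA (setIC _ (K j)) setIA SK set0I.
(* A point with a <= f < b and |f - h| < e/2 lies in [Z], and on [Z] each of f_j < a - e and f_j > b
   + e forces |f_j - h| >= e/2. *)
pose Z : set V := [set x | a - e / 2 < h x < b + e / 2].
have oZ : open Z.
  apply: (@open_comp _ _ h [set r | a - e / 2 < r < b + e / 2]).
    by move=> x _; exact: ch.
  rewrite (_ : [set r | _] = [set r | a - e / 2 < r] `&` [set r | r < b + e / 2]).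
    by apply: openI; [exact: open_gt|exact: open_lt].
  by apply/seteqP; split => r /= /andP.
have [j0 _ j0P] := cvge_near_lt fh (cvg_sqr_integralB bh).
exists j0, (Z `|` W); split; first exact: openU.
  move=> x [Sx /andP[ax xb]]; have [bad|good] := leP (e / 2) `|f x - h x|.
    by right; exact: BadW.
  by left; rewrite /Z /=; move: good; rewrite ltr_norml => /andP[]; lra.
move=> j /j0P fjh.
have half (A : set B) : measurable A -> 
    (forall x, A x -> Z x -> e / 2 <= `|f_ j x - h x|) ->
    (mus j (A `&` (Z `|` W)) < (d / 2)%:E)%E.
  move=> mA AZ.
  have mfh := mge _ (measurable_funB (mf_ j) mh).
  apply: (@le_lt_trans _ _ (mus j ([set x : B | e / 2 <= `|f_ j x - h x|]%R `|` W))).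
    apply: le_measure; rewrite ?inE.
    - by apply: measurableI => //; apply: open_borel; exact: openU.
    - by apply: measurableU => //; exact: open_borel.
    - by move=> x [Ax [Zx|Wx]]; [left; exact: AZ|right].
  apply: (le_lt_trans (measureU2 (mus j) mfh (open_borel oW))).
  rewrite [ltRHS](_ : _ = ((d / 4)%:E + (4 * (d / 16))%:E)%E); last first.
    by rewrite -EFinD; congr EFin; field.
  apply: lte_leD => //; first by rewrite fin_num_measure//; exact: open_borel.
  apply: lt_trans (sqr_markov (measurable_funB (mf_ j) mh) e20 fjh) _.
    by rewrite lte_fin; lra.
  exact: Wd.
rewrite [d]splitr EFinD; apply: lteD; apply: half.
- rewrite (_ : [set x | _] = f_ j @^-1` `]-oo, a - e[%classic); last first.
    by apply/seteqP; split => x /=; rewrite in_itv.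
  by rewrite -[X in measurable X]setTI; apply: mf_ => //; exact: measurable_itv.
- move=> x /= fx /andP[hx _]; rewrite ler_normr; apply/orP; right; lra.
- rewrite (_ : [set x | _] = f_ j @^-1` `]b + e, +oo[%classic); last first.
    by apply/seteqP; split => x /=; rewrite in_itv/= andbT.
  by rewrite -[X in measurable X]setTI; apply: mf_ => //; exact: measurable_itv.
- move=> x /= fx /andP[_ hx]; rewrite ler_normr; apply/orP; left; lra.
Qed.

End strong_limits.

(** * Sequences increasing to 0, sections of kernels, and integrals over sets of full measure *)

Lemma seq_up_to0_cvg {R : realType} (rs : nat -> R) :
  seq_up_to0 rs -> rs @ \oo --> 0^'-.
Proof.
move=> [rs0 [_ cvg_rs]] A A0.
have : \forall j \near \oo, rs j < 0 -> A (rs j).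
  exact: (cvg_rs [set r : R | r < 0 -> A r] A0).
by apply: filterS => j; apply; exact: rs0.
Qed.

Lemma seq_up_to0_shift {R : realType} (rs : nat -> R) N :
  seq_up_to0 rs -> seq_up_to0 (fun j => rs (j + N)%N).
Proof.
move=> [rs0 [nd_rs cvg_rs]]; split => //; split.
  by move=> i j ij; apply: nd_rs; rewrite leq_add2r.
by rewrite (cvg_shiftn N rs).
Qed.

Lemma sectionL_measurable {d1 d2 : measure_display} {T1 : measurableType d1}
    {T2 : measurableType d2} {R : realType} (A : set T1) (E : set T2)
    (F : T1 -> T2 -> R) x :
  measurable A -> measurable E ->
  measurable_fun (A `*` E) (fun p => F p.1 p.2) -> A x ->
  measurable_fun E (F x).
Proof.
move=> mA mE mF Ax.
apply: (@measurable_comp _ _ _ _ _ _ (A `*` E) (fun p => F p.1 p.2) E (pair x)).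
- exact: measurableX.
- by move=> _ [y Ey <-].
- exact: mF.
- exact: measurable_funTS (pair1_measurable x).
Qed.

Lemma integral_null_setC {d : measure_display} {T : measurableType d}
    {R : realType} (mu : {measure set T -> \bar R}) (A : set T) (g : T -> \bar R) :
  measurable A -> mu (~` A) = 0%E -> mu.-integrable [set: T] g ->
  (\int[mu]_(x in A) g x = \int[mu]_x g x)%E.
Proof.
move=> mA A0 ig.
by rewrite [RHS](negligible_integral (measurableC mA)) // setDE setCK setTI.
Qed.

(** * Measures carried by the boundary of a set *)

Section boundary_supp.
Context {R : realType} {n : nat}.
Local Notation V := 'rV[R]_n.
Local Notation B := (Borel R n).

Lemma closed_boundary (A : set V) : closed (boundary A).
Proof.
rewrite /boundary setDE; apply: closedI; first exact: closed_closure.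
by apply: open_closedC; exact: open_interior.
Qed.

Variables (m : {measure set B -> \bar R}) (A : set V).
Hypothesis mA : m (~` boundary A : set B) = 0%E.

Lemma supp_sub_boundary : supp m `<=` boundary A.
Proof.
move=> x mx; apply: contrapT => Ax.
have := mx _ (closed_openC (closed_boundary (A := A))) Ax.
by rewrite mA ltxx.
Qed.

Lemma supp_borel : measurable (supp m : set B).
Proof. exact: closed_borel (closed_supp (mu := m)). Qed.

(** Reconciles the two domains of integration: the norms are integrals over the boundary, weak limit
    values are integrals over the support. The two sets differ by a null set. *)
Lemma sqr_integral_supp (F : B -> R) : measurable_fun (boundary A : set B) F ->
  (\int[m]_x ((F \_ (supp m)) x ^+ 2)%:E =
   \int[m]_(x in (boundary A : set B)) (F x * F x)%:E)%E.
Proof.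
move=> mF; have msupp := supp_borel.
rewrite [RHS](@ge0_negligible_integral _ _ _ m _ (~` supp m)) //.
- rewrite (_ : _ `\` _ = (supp m : set B)); last first.
    rewrite setDE setCK; apply/seteqP; split => [x []//|x mx].
    by split => //; exact: supp_sub_boundary.
  rewrite [RHS]integral_mkcond; apply: eq_integral => x _.
  by rewrite !patchE; case: ifP => // _; rewrite expr0n.
- exact: measurableC.
- exact: closed_borel (closed_boundary (A := A)).
- by apply/measurable_EFinP; exact: measurable_funM.
- by move=> x _; rewrite lee_fin -expr2 sqr_ge0.
- exact: setC_supp_null.
Qed.

Lemma measurable_fun_supp (F : B -> R) :
  measurable_fun (boundary A : set B) F -> measurable_fun (supp m : set B) F.
Proof.
apply: measurable_funS; last exact: supp_sub_boundary.
exact: closed_borel (closed_boundary (A := A)).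
Qed.

Lemma measurable_restrict_supp (F : B -> R) :
  measurable_fun (boundary A : set B) F ->
  measurable_fun [set: B] (F \_ (supp m)).
Proof.
by move=> /measurable_fun_supp; exact: (measurable_restrictT F supp_borel).1.
Qed.

Lemma measurable_supp_preimage (F : B -> R) (Y : set R) :
  measurable_fun (boundary A : set B) F -> measurable Y ->
  measurable [set x : B | supp m x /\ Y (F x)].
Proof. by move=> /measurable_fun_supp mF; exact: (mF supp_borel). Qed.

End boundary_supp.

(** * Reduction of the theorem to the abstract setting *)

Theorem theorem5p3 (R : realType) (n : nat)
  (D : set 'rV[R]_n) (Dr : R -> set 'rV[R]_n)
  (mur : R -> {finite_measure set (Borel R n) -> \bar R})
  (mu : {finite_measure set (Borel R n) -> \bar R})
  (P : R -> 'rV[R]_n -> 'rV[R]_n -> R) (P0 : 'rV[R]_n -> 'rV[R]_n -> R) :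
  (* standing setting *)
  domain D -> bounded_set D ->
  (forall r, r < 0 -> domain (Dr r)) ->
  (forall r s, r < s -> s < 0 ->
     compact (closure (Dr r)) /\ closure (Dr r) `<=` Dr s) ->
  \bigcup_(r in [set r : R | r < 0]) Dr r = D ->
  (forall r, r < 0 -> mur r (~` boundary (Dr r) : set (Borel R n)) = 0%E) ->
  mu (~` boundary D : set (Borel R n)) = 0%E ->
  (forall h : 'rV[R]_n -> R, {within closure D, continuous h} ->
     (fun r => (\int[mur r]_(x in (closure D : set (Borel R n))) (h x)%:E)%E)
       @ 0^'- --> (\int[mu]_(x in (closure D : set (Borel R n))) (h x)%:E)%E) ->
  (* Borel kernels *)
  (forall r, r < 0 ->
     measurable_fun (Dr r `*` boundary (Dr r) : set (Borel R n * Borel R n))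
       (fun p : Borel R n * Borel R n => P r p.1 p.2)) ->
  measurable_fun (D `*` boundary D : set (Borel R n * Borel R n))
    (fun p : Borel R n * Borel R n => P0 p.1 p.2) ->
  (* (1) non-negative and uniformly bounded for r close to 0 *)
  (forall z, D z -> exists r0 C : R, r0 < 0 /\
     forall r, r0 < r -> r < 0 -> forall zeta, boundary (Dr r) zeta ->
       0 <= P r z zeta <= C) ->
  (* (2) weak limit values *)
  (forall z, D z -> forall rs : nat -> R, seq_up_to0 rs ->
     weak_limit_values (closure D) (fun j => mur (rs j)) (fun j => P (rs j) z)
       mu (P0 z)) ->
  (* (3) Q_0(z,z) = lim_{r -> 0^-} Q_r(z,z) *)
  (forall z, D z ->
     (fun r => (\int[mur r]_(zeta in (boundary (Dr r) : set (Borel R n)))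
                   (P r z zeta * P r z zeta)%:E)%E)
       @ 0^'- --> (\int[mu]_(zeta in (boundary D : set (Borel R n)))
                   (P0 z zeta * P0 z zeta)%:E)%E) ->
  forall z, D z -> forall rs : nat -> R, seq_up_to0 rs ->
    strong_limit_values (closure D) (fun j => mur (rs j)) (fun j => P (rs j) z)
      mu (P0 z).
Proof.
move=> domD _ domDr nest cupDr mur_bd mu_bd weak_mu mP mP0 bnd weakP sqrP z Dz rs rs_up.
have oD : open D by case: domD.
have oDr r : r < 0 -> open (Dr r) by move=> /domDr[].
have DrD r : r < 0 -> closure (Dr r) `<=` D.
  (* Any parameter strictly between r and 0 would do; r/2 is one. *)
  move=> r0 x cx; rewrite -cupDr; exists (r / 2); first by rewrite /=; lra.
  by have [_] := @nest r (r / 2) ltac:(lra) ltac:(lra); apply.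
have Dr_mono r s : r <= s -> s < 0 -> closure (Dr r) `<=` closure (Dr s).
  rewrite le_eqVlt => /predU1P[->_|lt_rs s0]; first exact: subset_refl.
  by have [_ /subset_trans] := nest r s lt_rs s0; apply; exact: subset_closure.
have [r1 r10 Dr1z] : exists2 r, r < 0 & Dr r z.
  by move: Dz; rewrite -cupDr => -[r]; exists r.
have [r0 [C [r00 PC]]] := bnd z Dz.
(* Beyond [N] the point [z] lies in the domains of the sequence and the uniform bound of (1)
   applies. The hypotheses are then used along the shifted sequence. *)
have [N NP] : exists N, forall j, Num.max r0 r1 < rs (j + N)%N.
  have [_ [_ /cvgr_gt]] := rs_up.
  move=> /(_ (Num.max r0 r1)); rewrite gt_max r00 r10 => /(_ isT)[N _ NP].
  by exists N => j; apply: NP; rewrite /= leq_addl.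
pose rs' j := rs (j + N)%N.
have rs'_up : seq_up_to0 rs' := seq_up_to0_shift N rs_up.
have rs'0 j : rs' j < 0 by case: rs'_up.
have Drz j : Dr (rs' j) z.
  have : r1 < rs' j by apply: le_lt_trans (NP j); rewrite le_max lexx orbT.
  move=> r1j; have [_] := nest _ _ r1j (rs'0 j); apply.
  exact: subset_closure.
have [int_P0 weak_f] := weakP z Dz rs' rs'_up.
pose K j := closure (Dr (rs' j)).
have musK j : mur (rs' j) (~` K j : set (Borel R n)) = 0%E.
  apply: subset_measure0 (mur_bd _ (rs'0 j)).
  - exact: open_borel (closed_openC (@closed_closure _ _)).
  - exact: open_borel (closed_openC (@closed_boundary _ _ _)).
  - by move=> x Kx [].
have bdK j : boundary D `&` K j = set0.
  rewrite -subset0 => x [[_ nD] Kx]; apply: nD.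
  by move/interior_id : oD => ->; exact: DrD Kx.
have mbd (A : set 'rV[R]_n) : measurable (boundary A : set (Borel R n)).
  exact: closed_borel (@closed_boundary _ _ _).
have mPj j :
    measurable_fun (boundary (Dr (rs' j)) : set (Borel R n)) (P (rs' j) z).
  have mDr := open_borel (oDr _ (rs'0 j)).
  exact: (sectionL_measurable mDr (mbd _) (mP _ (rs'0 j)) (Drz j)).
have mP0z : measurable_fun (boundary D : set (Borel R n)) (P0 z).
  exact: (sectionL_measurable (open_borel oD) (mbd _) mP0 Dz).
(* The kernels are only known to be measurable on the boundaries. Extension by zero off the supports
   makes them measurable everywhere and turns the integrals into integrals over the whole space. *)
pose f_ j : Borel R n -> R := P (rs' j) z \_ (supp (mur (rs' j))).
pose f : Borel R n -> R := P0 z \_ (supp mu).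
have mf_ j : measurable_fun setT (f_ j).
  by have := measurable_restrict_supp (mur_bd _ (rs'0 j)) (mPj j).
have mf : measurable_fun setT f by have := measurable_restrict_supp mu_bd mP0z.
have cvg_along (F : R -> \bar R) l : F @ 0^'- --> l -> (F \o rs') @ \oo --> l.
  by apply: cvg_comp; exact: seq_up_to0_cvg.
have mclD : measurable (closure D : set (Borel R n)).
  exact: closed_borel (@closed_closure _ _).
have null_clD (m : {measure set Borel R n -> \bar R}) A : A `<=` D ->
    m (~` boundary A : set (Borel R n)) = 0%E ->
    m (~` closure D : set (Borel R n)) = 0%E.
  move=> AD; apply: subset_measure0; [exact: measurableC|exact: measurableC|].
  by move=> x nD [/(closureS AD)].
have DrsD r : r < 0 -> Dr r `<=` D.
  by move=> r_lt0 x /subset_closure; exact: DrD.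
have weak_cvg h : bounded_continuous h ->
    (fun j => \int[mur (rs' j)]_x (h x)%:E)%E @ \oo --> (\int[mu]_x (h x)%:E)%E.
  move=> bh; have [ch _] := bh.
  have /cvg_along := weak_mu h (continuous_subspaceT ch).
  rewrite (integral_null_setC mclD (null_clD _ _ (@subset_refl _ _) mu_bd)); last first.
    exact: bounded_continuous_integrable.
  apply: cvg_trans; apply: near_eq_cvg; near=> j => /=.
  have null_j := null_clD _ _ (DrsD _ (rs'0 j)) (mur_bd _ (rs'0 j)).
  rewrite (integral_null_setC mclD null_j)//.
  exact: bounded_continuous_integrable.
have weak_fr h : bounded_continuous h ->
    (fun j => \int[mur (rs' j)]_x (h x * f_ j x)%:E)%E @ \oo -->
    (\int[mu]_x (h x * f x)%:E)%E.
  move=> [ch _]; have := weak_f h (continuous_subspaceT ch).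
  have restr (m : {measure set Borel R n -> \bar R}) (g : Borel R n -> R) :
      (\int[m]_(x in (supp m : set (Borel R n))) (h x * g x)%:E =
       \int[m]_x (h x * (g \_ (supp m)) x)%:E)%E.
    rewrite integral_mkcond; apply: eq_integral => x _.
    by rewrite !patchE; case: ifP => // _; rewrite mulr0.
  by rewrite restr; under eq_fun do rewrite restr.
have sqr_f : (fun j => \int[mur (rs' j)]_x (f_ j x ^+ 2)%:E)%E @ \oo -->
    (\int[mu]_x (f x ^+ 2)%:E)%E.
  have /cvg_along := sqrP z Dz; rewrite -(sqr_integral_supp mu_bd mP0z).
  apply: cvg_trans; apply: near_eq_cvg; near=> j => /=.
  by rewrite -(sqr_integral_supp (mur_bd _ (rs'0 j)) (mPj j)).
have bC : bounded_continuous (cst (C ^+ 2) : 'rV[R]_n -> R).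
  by split; [exact: cst_continuous|exists `|C ^+ 2|].
(* Square integrability of the limit comes from (1): 0 <= P <= C bounds the square integrals by C^2
   times the total masses, and both sides converge. *)
have sqr_fin : (\int[mu]_x (f x ^+ 2)%:E < +oo)%E.
  apply: (@le_lt_trans _ _ (\int[mu]_x (cst (C ^+ 2) x)%:E)%E); last first.
    have := integrable_fin_num measurableT (bounded_continuous_integrable mu bC).
    by rewrite fin_numElt => /andP[].
  apply: lee_cvg_to sqr_f (weak_cvg _ bC) _; near=> j.
  apply: ge0_le_integral => //.
  - by move=> x _; rewrite lee_fin sqr_ge0.
  - exact: measurable_EFin_sqr.
  - by apply/measurable_EFinP; exact: measurable_cst.
  move=> x _; rewrite lee_fin /f_ patchE; case: ifPn => [xs|_]; last first.
    by rewrite expr0n sqr_ge0.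
  have r0j : r0 < rs' j by apply: le_lt_trans (NP j); rewrite le_max lexx.
  have bx := supp_sub_boundary (mur_bd _ (rs'0 j)) (set_mem xs).
  have /andP[Pge0 PleC] := PC _ r0j (rs'0 j) x bx.
  by rewrite lerXn2r// nnegrE (le_trans Pge0 PleC).
split; first by have := measurable_fun_supp mu_bd mP0z.
move=> a b e d _ e0 d0.
have [j0 [G [oG SG Gsmall]]] := strong_limit
  (fun j => @closed_closure _ (Dr (rs' j)))
  (fun i j ij => Dr_mono _ _ (proj1 (proj2 rs'_up) i j ij) (rs'0 j))
  musK weak_cvg mf_ mf weak_fr sqr_f sqr_fin (S := boundary D) a b (mbd D) bdK e0 d0.
(* Adding [N] undoes the shift: every index from [j0 + N] on is [i + N] with [j0 <= i]. *)
exists (j0 + N)%N, (G `&` closure D); split; first by exists G.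
split.
  move=> x [mx ab]; have Sx := supp_sub_boundary mu_bd mx; split; last by case: Sx.
  by apply: SG; split => //; rewrite /f patchE mem_set.
move=> j j0j; have [i i0 ->] : exists2 i, (j0 <= i)%N & j = (i + N)%N.
  by exists (j - N)%N; [rewrite leq_subRL|rewrite subnK]; rewrite 1?addnC;
    rewrite ?(leq_trans (leq_addl j0 N)).
apply: le_lt_trans (Gsmall i i0).
have mG : measurable (G : set (Borel R n)) := open_borel oG.
(* On the support the kernel agrees with its extension by zero. Elsewhere the extension can only
   enlarge the preimage of [Y], so an inequality between measures suffices. *)
pose supp_preim Y : set (Borel R n) :=
  [set x | supp (mur (rs' i)) x /\ Y (P (rs' i) z x)].
have le_part Y : measurable Y ->
    (mur (rs' i) (supp_preim Y `&` (G `&` closure D)) <=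
     mur (rs' i) (f_ i @^-1` Y `&` G))%E.
  move=> mY; have mlh : measurable (supp_preim Y).
    by have := measurable_supp_preimage (mur_bd _ (rs'0 i)) (mPj i) mY.
  apply: le_measure; rewrite ?inE.
  - by apply: measurableI => //; exact: measurableI.
  - by apply: measurableI => //; rewrite -[X in measurable X]setTI; exact: mf_.
  - by move=> x [[sx Yx] [Gx _]]; split => //; rewrite /= /f_ patchE mem_set.
apply: leeD.
  apply: (le_part [set r | r < a - e]).
  by rewrite -set_itvNyo; exact: measurable_itv.
apply: (le_part [set r | b + e < r]).
by rewrite -set_itvoy; exact: measurable_itv.
Unshelve. all: by end_near. Qed.
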